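(* Let $A$ be a semisimple cellular algebra over $\mathbb{C}$ with cell datum $(\Lambda,M,C,i)$. For $\lambda\in\Lambda$ let $W(\lambda)$ be the corresponding cell module, and let $\Lambda'=\{\lambda\in\Lambda \mid W(\lambda)\neq 0\}$, so that the $W(\lambda)$, $\lambda\in\Lambda'$, are the simple $A$-modules up to isomorphism. Then the Plesken Lie algebra $\mathcal{L}(A)=\mathrm{span}_{\mathbb{C}}\{a-i(a)\mid a\in A\}$ of $A$ with respect to the anti-involution $i$ is isomorphic, as a complex Lie algebra, to a direct sum of orthogonal Lie algebras: $$\mathcal{L}(A)\cong\bigoplus_{\lambda\in\Lambda'}\mathfrak{o}(\dim W(\lambda),\mathbb{C}).$$
   Context: Algebras are associative with identity. An anti-involution of a $K$-algebra $A$ is a $K$-linear map $\sigma:A\to A$ with $\sigma(ab)=\sigma(b)\sigma(a)$ for all $a,b\in A$ and $\sigma^2=\mathrm{id}_A$. The Plesken Lie algebra of $A$ with respect to $\sigma$ is the subspace $\mathcal{L}(A)=\mathrm{span}\{a-\sigma(a)\mid a\in A\}$ of $A$, with Lie bracket $[x,y]=xy-yx$; this is a Lie subalgebra of $A$ equipped with the commutator bracket. A cellular algebra over a field $K$ is an associative $K$-algebra $A$ together with a cell datum $(\Lambda,M,C,i)$, where: (C1) $\Lambda$ is a finite partially ordered set; for each $\lambda\in\Lambda$ there is a non-empty finite set $M(\lambda)$, and $C:\bigsqcup_{\lambda\in\Lambda}M(\lambda)\times M(\lambda)\to A$ is an injective map whose image is a $K$-basis of $A$. For $s,t\in M(\lambda)$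 write $C^{\lambda}_{s,t}:=C(s,t)$. (C2) $i:A\to A$ is a $K$-linear anti-involution with $i(C^{\lambda}_{s,t})=C^{\lambda}_{t,s}$ for all $\lambda\in\Lambda$, $s,t\in M(\lambda)$. (C3) For all $\lambda\in\Lambda$, $s,t\in M(\lambda)$ and $a\in A$ there exist scalars $r_a(s',s)\in K$ ($s'\in M(\lambda)$), independent of $t$, such that $$aC^{\lambda}_{s,t}\equiv\sum_{s'\in M(\lambda)}r_a(s',s)\,C^{\lambda}_{s',t}\pmod{A(<\lambda)},$$ where $A(<\lambda)$ is the $K$-span of all $C^{\mu}_{v,w}$ with $\mu<\lambda$, $v,w\in M(\mu)$. The cell module $W(\lambda)$ is the $K$-vector space with basis $\{C_s\mid s\in M(\lambda)\}$ and $A$-action $aC_s=\sum_{s'\in M(\lambda)}r_a(s',s)C_{s'}$. For $m\in\mathbb{N}$, $\mathfrak{o}(m,\mathbb{C})$ is the Lie algebra of skew-symmetric complex $m\times m$ matrices with the commutator bracket. *)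

(* Defs.v *)
From HB Require Import structures.
From mathcomp Require Import all_boot all_order all_algebra.
From mathcomp Require Import boolp.
Set Implicit Arguments.
Unset Strict Implicit.
Unset Printing Implicit Defensive.
Import Order.TTheory GRing.Theory.
Local Open Scope ring_scope.

HB.mixin Record Lmodule_isLieAlgebra (K : pzRingType) L
    of GRing.Lmodule K L := {
  lie : L -> L -> L;
  lie_linearl : forall z : L, linear (lie^~ z);
  lie_linearr : forall z : L, linear (lie z);
  liexx : forall x : L, lie x x = 0;
  lie_jacobi : forall x y z : L,
    lie x (lie y z) + lie y (lie z x) + lie z (lie x y) = 0
}.
#[short(type="lieAlgType")]
HB.structure Definition LieAlgebra (K : pzRingType) :=
  {L of GRing.Lmodule K L & Lmodule_isLieAlgebra K L}.

Definition lie_isomorphic (K : pzRingType) (L1 L2 : lieAlgType K) : Prop :=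
  exists2 f : {linear L1 -> L2}, bijective f & {morph f : x y / lie x y}.

Section Lspan.
Variables (K : pzRingType) (V : lmodType K).

Definition lspan (X : V -> Prop) (x : V) : Prop :=
  exists2 s : seq (K * V),
    (forall p, p \in s -> X p.2) & x = \sum_(p <- s) p.1 *: p.2.

Lemma lspan_gen X x : X x -> lspan X x.
Proof.
move=> Xx; exists [:: (1, x)]; first by move=> p; rewrite inE => /eqP ->.
by rewrite big_seq1 /= scale1r.
Qed.

Lemma lspan0 X : lspan X 0.
Proof. by exists [::] => //; rewrite big_nil. Qed.

Lemma lspanD X x y : lspan X x -> lspan X y -> lspan X (x + y).
Proof.
move=> [s sX ->] [t tX ->]; exists (s ++ t); last by rewrite big_cat.
by move=> p; rewrite mem_cat => /orP[/sX|/tX].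
Qed.

Lemma lspanZ X k x : lspan X x -> lspan X (k *: x).
Proof.
move=> [s sX ->]; exists [seq (k * p.1, p.2) | p <- s].
  by move=> _ /mapP[q qs ->]; apply: (sX q).
by rewrite big_map scaler_sumr; apply: eq_bigr => p _; rewrite scalerA.
Qed.

Lemma lspan_sum X (I : Type) (r : seq I) (F : I -> V) :
  (forall i, lspan X (F i)) -> lspan X (\sum_(i <- r) F i).
Proof.
by move=> XF; elim/big_ind: _ => //; [exact: lspan0|exact: lspanD].
Qed.

Lemma lspan_ind X (P : V -> Prop) :
  P 0 -> (forall x y, P x -> P y -> P (x + y)) ->
  (forall k x, P x -> P (k *: x)) -> (forall x, X x -> P x) ->
  forall x, lspan X x -> P x.
Proof.
move=> P0 PD PZ PX _ [s sX ->].
rewrite big_seq; elim/big_ind: _ => // p ps; exact/PZ/PX/sX.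
Qed.

End Lspan.

Lemma jacobi_sum (V : zmodType) (a b c d e f : V) :
  (a - b - (c - d)) + (c - e - (f - b)) + (f - d - (a - e)) = 0.
Proof.
have H (p q r s : V) : p - q - (r - s) = (p + s) - (q + r).
  by rewrite opprB addrACA -opprD.
rewrite !H [c + b]addrC [f + e]addrC subrKA [d + a]addrC.
by rewrite subrKA subrr.
Qed.

Section SubLie.
Variables (K : pzRingType) (L : lieAlgType K).

Record lie_subalgebra := LieSubalgebra {
  lie_sub_pred : {pred L};
  lie_sub_submod : submod_closed lie_sub_pred;
  lie_sub_lie : {in lie_sub_pred &, forall x y, lie x y \in lie_sub_pred}
}.

Variable S : lie_subalgebra.

HB.instance Definition _ :=
  GRing.isSubmodClosed.Build K L (lie_sub_pred S) (lie_sub_submod S).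

Definition lie_sub_type : Type := {x : L | x \in lie_sub_pred S}.

HB.instance Definition _ := SubChoice.on lie_sub_type.
HB.instance Definition _ := [SubChoice_isSubZmodule of lie_sub_type by <:].
HB.instance Definition _ := [SubZmodule_isSubLmodule of lie_sub_type by <:].

Definition sub_lie (x y : lie_sub_type) : lie_sub_type :=
  Sub (lie (val x) (val y)) (lie_sub_lie (valP x) (valP y)).

Lemma val_sub_lie x y : val (sub_lie x y) = lie (val x) (val y).
Proof. exact: SubK. Qed.

Fact sub_lie_linearl z : linear (sub_lie^~ z).
Proof.
by move=> k x y; apply: val_inj; rewrite linearP !val_sub_lie linearP
  /= lie_linearl.
Qed.

Fact sub_lie_linearr z : linear (sub_lie z).
Proof.
by move=> k x y; apply: val_inj; rewrite linearP !val_sub_lie linearP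
  /= lie_linearr.
Qed.

Fact sub_liexx x : sub_lie x x = 0.
Proof. by apply: val_inj; rewrite val_sub_lie liexx raddf0. Qed.

Fact sub_lie_jacobi x y z :
  sub_lie x (sub_lie y z) + sub_lie y (sub_lie z x) + sub_lie z (sub_lie x y)
    = 0.
Proof. by apply: val_inj; rewrite !raddfD raddf0 /= lie_jacobi. Qed.

HB.instance Definition _ := Lmodule_isLieAlgebra.Build K lie_sub_type
  sub_lie_linearl sub_lie_linearr sub_liexx sub_lie_jacobi.

End SubLie.

Section DirectSum.
Variables (K : pzRingType) (I : finType) (L : I -> lieAlgType K).

Definition lie_dsum : Type := {dffun forall i, L i}.
HB.instance Definition _ := Choice.on lie_dsum.
Implicit Types f g h : lie_dsum.

Definition dsum_add f g : lie_dsum := [ffun i => f i + g i].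
Definition dsum_opp f : lie_dsum := [ffun i => - f i].
Definition dsum_zero : lie_dsum := [ffun i => 0].
Definition dsum_scale (k : K) f : lie_dsum := [ffun i => k *: f i].
Definition dsum_lie f g : lie_dsum := [ffun i => lie (f i) (g i)].

Fact dsum_addA : associative dsum_add.
Proof. by move=> f g h; apply/ffunP => i; rewrite !ffunE addrA. Qed.
Fact dsum_addC : commutative dsum_add.
Proof. by move=> f g; apply/ffunP => i; rewrite !ffunE addrC. Qed.
Fact dsum_add0 : left_id dsum_zero dsum_add.
Proof. by move=> f; apply/ffunP => i; rewrite !ffunE add0r. Qed.
Fact dsum_addN : left_inverse dsum_zero dsum_opp dsum_add.
Proof. by move=> f; apply/ffunP => i; rewrite !ffunE addNr. Qed.

HB.instance Definition _ := GRing.isZmodule.Build lie_dsum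
  dsum_addA dsum_addC dsum_add0 dsum_addN.

Fact dsum_scaleA a b f : dsum_scale a (dsum_scale b f) = dsum_scale (a * b) f.
Proof. by apply/ffunP => i; rewrite !ffunE scalerA. Qed.
Fact dsum_scale1 : left_id 1 dsum_scale.
Proof. by move=> f; apply/ffunP => i; rewrite !ffunE scale1r. Qed.
Fact dsum_scaleDr : right_distributive dsum_scale +%R.
Proof. by move=> a f g; apply/ffunP => i; rewrite !ffunE scalerDr. Qed.
Fact dsum_scaleDl f : {morph dsum_scale^~ f : a b / a + b}.
Proof. by move=> a b; apply/ffunP => i; rewrite !ffunE scalerDl. Qed.

HB.instance Definition _ := GRing.Zmodule_isLmodule.Build K lie_dsum
  dsum_scaleA dsum_scale1 dsum_scaleDr dsum_scaleDl.

Fact dsum_lie_linearl h : linear (dsum_lie^~ h).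
Proof. by move=> a f g; apply/ffunP => i; rewrite !ffunE lie_linearl. Qed.
Fact dsum_lie_linearr h : linear (dsum_lie h).
Proof. by move=> a f g; apply/ffunP => i; rewrite !ffunE lie_linearr. Qed.
Fact dsum_liexx f : dsum_lie f f = 0.
Proof. by apply/ffunP => i; rewrite !ffunE liexx. Qed.
Fact dsum_lie_jacobi f g h :
  dsum_lie f (dsum_lie g h) + dsum_lie g (dsum_lie h f)
    + dsum_lie h (dsum_lie f g) = 0.
Proof. by apply/ffunP => i; rewrite !ffunE lie_jacobi. Qed.

HB.instance Definition _ := Lmodule_isLieAlgebra.Build K lie_dsum
  dsum_lie_linearl dsum_lie_linearr dsum_liexx dsum_lie_jacobi.

End DirectSum.

Section CommutatorLie.
Variables (K : pzRingType) (A : algType K).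

Definition comm_lie : Type := A.
HB.instance Definition _ := GRing.Lmodule.on comm_lie.

Definition alg_lie (x y : comm_lie) : comm_lie := (x : A) * y - (y : A) * x.

Fact alg_lie_linearr z : linear (alg_lie z).
Proof.
move=> k x y; rewrite /alg_lie mulrDl mulrDr -scalerAl -scalerAr.
by rewrite scalerBr opprD addrACA.
Qed.
Fact alg_lie_linearl z : linear (alg_lie^~ z).
Proof.
move=> k x y; rewrite /alg_lie mulrDl mulrDr -scalerAl -scalerAr.
by rewrite scalerBr opprD addrACA.
Qed.
Fact alg_liexx x : alg_lie x x = 0.
Proof. exact: subrr. Qed.
Fact alg_lie_jacobi x y z :
  alg_lie x (alg_lie y z) + alg_lie y (alg_lie z x) + alg_lie z (alg_lie x y)
    = 0.
Proof.
rewrite /alg_lie !(mulrBr (_ : A)) !(mulrBl (_ : A)) !(mulrA (_ : A)).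
exact: jacobi_sum.
Qed.

HB.instance Definition _ := Lmodule_isLieAlgebra.Build K comm_lie
  alg_lie_linearl alg_lie_linearr alg_liexx alg_lie_jacobi.

End CommutatorLie.

Section Orthogonal.
Variables (K : comPzRingType) (m : nat).

Definition gl_lie : Type := 'M[K]_m.
HB.instance Definition _ := GRing.Lmodule.on gl_lie.

Definition mx_lie (x y : gl_lie) : gl_lie := x *m y - y *m x.

Fact mx_lie_linearr z : linear (mx_lie z).
Proof.
move=> k x y; rewrite /mx_lie mulmxDl mulmxDr -scalemxAl -scalemxAr.
by rewrite scalerBr opprD addrACA.
Qed.
Fact mx_lie_linearl z : linear (mx_lie^~ z).
Proof.
move=> k x y; rewrite /mx_lie mulmxDl mulmxDr -scalemxAl -scalemxAr.
by rewrite scalerBr opprD addrACA.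
Qed.
Fact mx_liexx x : mx_lie x x = 0.
Proof. exact: subrr. Qed.
Fact mx_lie_jacobi x y z :
  mx_lie x (mx_lie y z) + mx_lie y (mx_lie z x) + mx_lie z (mx_lie x y) = 0.
Proof. by rewrite /mx_lie !mulmxBr !mulmxBl !mulmxA jacobi_sum. Qed.

HB.instance Definition _ := Lmodule_isLieAlgebra.Build K gl_lie
  mx_lie_linearl mx_lie_linearr mx_liexx mx_lie_jacobi.

Definition skew_pred : {pred gl_lie} := [pred x : 'M[K]_m | x^T == - x].

Fact skew_submod : submod_closed skew_pred.
Proof.
split=> [|k x y]; first by rewrite inE /= trmx0 oppr0.
rewrite !inE /= => /eqP Ex /eqP Ey.
by rewrite linearP /= Ex Ey scalerN opprD.
Qed.

Fact skew_lie : {in skew_pred &, forall x y, lie x y \in skew_pred}.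
Proof.
move=> x y; rewrite !inE /= /lie /= /mx_lie => /eqP Ex /eqP Ey.
by rewrite linearB /= !trmx_mul Ex Ey !mulNmx !mulmxN !opprK opprB.
Qed.

Definition skew_lie_subalgebra := LieSubalgebra skew_submod skew_lie.
Definition orthogonal_lie : lieAlgType K := lie_sub_type skew_lie_subalgebra.

End Orthogonal.

Section Plesken.
Variables (K : fieldType) (A : algType K).

Record anti_involution := AntiInvolution {
  anti_inv_fun :> {linear A -> A};
  anti_invM : forall a b, anti_inv_fun (a * b) = anti_inv_fun b * anti_inv_fun a;
  anti_invK : involutive anti_inv_fun
}.

Variable sigma : anti_involution.

Definition plesken_gen (x : A) : Prop := exists a : A, x = a - sigma a.

Definition plesken_pred : {pred comm_lie A} :=
  [pred x : A | `[< lspan plesken_gen x >]].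

Lemma plesken_lspanP x : lspan plesken_gen x -> sigma x = - x.
Proof.
elim/lspan_ind: x / => [|x y Ex Ey|k x Ex|_ [a ->]].
- by rewrite raddf0 oppr0.
- by rewrite raddfD /= Ex Ey opprD.
- by rewrite linearZ /= Ex scalerN.
- by rewrite raddfB /= anti_invK opprB.
Qed.

Fact plesken_submod : submod_closed plesken_pred.
Proof.
split=> [|k x y]; rewrite !inE; first exact/asboolP/lspan0.
by move=> /asboolP px /asboolP py; apply/asboolP/lspanD/py/lspanZ.
Qed.

Fact plesken_lie : {in plesken_pred &, forall x y, lie x y \in plesken_pred}.
Proof.
move=> x y; rewrite !inE => /asboolP/plesken_lspanP Ex /asboolP/plesken_lspanP Ey.
apply/asboolP/lspan_gen; exists ((x : A) * y).
by rewrite anti_invM Ex Ey mulrNN.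
Qed.

Definition plesken_lie_subalgebra := LieSubalgebra plesken_submod plesken_lie.
Definition plesken_lie_algebra : lieAlgType K :=
  lie_sub_type plesken_lie_subalgebra.

End Plesken.

Section Modules.
Variable A : pzRingType.

Definition simple_submodule (V : lmodType A) (S : {pred V}) : Prop :=
  [/\ submod_closed S,
      exists2 v, v \in S & v != 0
    & forall T : {pred V}, submod_closed T -> {subset T <= S} ->
        {in T, forall v, v = 0} \/ {subset S <= T}].

Definition simple_module (V : lmodType A) : Prop :=
  simple_submodule (predT : {pred V}).

Definition module_isomorphic (V W : lmodType A) : Prop :=
  exists f : {linear V -> W}, bijective f.

(* The regular module is an internal direct sum of simple submodules; finite  *)
(* families suffice because it is generated by [1].                           *)
Definition semisimple_ring : Prop :=
  exists (n : nat) (S : 'I_n -> {pred A^o}),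
    (forall j, simple_submodule (S j)) /\
    (forall a : A^o, exists! v : {ffun 'I_n -> A^o},
       (forall j, v j \in S j) /\ a = \sum_j v j).

End Modules.

Section Cellular.
Variables (K : fieldType) (A : algType K).

Record cell_datum := CellDatum {
  cell_disp : Order.disp_t;
  cell_poset : finPOrderType cell_disp;
  cell_idx : cell_poset -> finType;
  cell_idx_gt0 : forall l, (0 < #|cell_idx l|)%N;
  cellC : forall l, cell_idx l -> cell_idx l -> A;
  cellC_inj : injective
    (fun u : {l : cell_poset & (cell_idx l * cell_idx l)%type} =>
       cellC (tagged u).1 (tagged u).2);
  cellC_basis : forall a : A,
    exists! c : {ffun {l : cell_poset & (cell_idx l * cell_idx l)%type} -> K},
      a = \sum_u c u *: cellC (tagged u).1 (tagged u).2;
  cell_inv : anti_involution A;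
  cell_invC : forall l (s t : cell_idx l), cell_inv (cellC s t) = cellC t s;
  cell_mulC : forall l (s : cell_idx l) (a : A),
    exists r : {ffun cell_idx l -> K}, forall t : cell_idx l,
      lspan (fun x : A => exists (mu : cell_poset) (v w : cell_idx mu),
               (mu < l)%O /\ x = cellC v w)
        (a * cellC s t - \sum_s' r s' *: cellC s' t)
}.

Variable D : cell_datum.

Definition cell_lower (l : cell_poset D) : A -> Prop :=
  lspan (fun x : A => exists (mu : cell_poset D) (v w : cell_idx mu),
           (mu < l)%O /\ x = cellC v w).

(* [cell_coef a s s'] is r_a(s', s). *)
Definition cell_coef (l : cell_poset D) (a : A) (s : cell_idx l)
    : {ffun cell_idx l -> K} :=
  sval (cid (cell_mulC s a)).

Lemma cell_coefP (l : cell_poset D) (a : A) (s t : cell_idx l) :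
  cell_lower l (a * cellC s t - \sum_s' cell_coef a s s' *: cellC s' t).
Proof. by rewrite /cell_coef; case: cid => r /= rP; apply: rP. Qed.

(* W(l) as a vector space: [w] stands for the sum of the w(s) C_s. *)
Definition cell_space (l : cell_poset D) : Type := {ffun cell_idx l -> K^o}.
HB.instance Definition _ l := Vector.on (cell_space l).

Definition cell_act (l : cell_poset D) (a : A) (w : cell_space l)
    : cell_space l :=
  [ffun s' => \sum_s cell_coef a s s' * w s].

Let index : finType := {l : cell_poset D & (cell_idx l * cell_idx l)%type}.
Let gen (u : index) : A := cellC (tagged u).1 (tagged u).2.

Definition cell_coord (a : A) : {ffun index -> K} :=
  sval (cid (cellC_basis D a)).

Lemma cell_coordP a : a = \sum_u cell_coord a u *: gen u.
Proof. by rewrite /cell_coord; case: cid => c []. Qed.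

Lemma cell_coord_uniq a (c : {ffun index -> K}) :
  a = \sum_u c u *: gen u -> cell_coord a = c.
Proof. by rewrite /cell_coord; case: cid => d /= [_ H] /H. Qed.

Lemma cell_coord_linear (k : K) (a b : A) u :
  cell_coord (k *: a + b) u = k * cell_coord a u + cell_coord b u.
Proof.
rewrite (@cell_coord_uniq _ [ffun v => k * cell_coord a v + cell_coord b v]).
  by rewrite ffunE.
rewrite {1}(cell_coordP a) {1}(cell_coordP b) scaler_sumr -big_split /=.
by apply: eq_bigr => v _; rewrite ffunE scalerDl scalerA.
Qed.

Lemma cell_coordC (l mu : cell_poset D) (s t : cell_idx l) (v w : cell_idx mu) :
  cell_coord (cellC s t) (Tagged _ (v, w)) =
  (Tagged (fun l => cell_idx l * cell_idx l)%type (s, t)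
     == Tagged _ (v, w) :> index)%:R.
Proof.
set u0 : index := Tagged _ (s, t).
rewrite (@cell_coord_uniq _ [ffun u => (u0 == u)%:R]) ?ffunE //.
rewrite (bigD1 u0) //= big1 ?addr0 => [|u nu].
  by rewrite ffunE eqxx scale1r.
by rewrite ffunE eq_sym (negPf nu) scale0r.
Qed.

Lemma cell_coord0 u : cell_coord 0 u = 0.
Proof.
have := cell_coord_linear 1 0 0 u; rewrite scaler0 addr0 mul1r.
by move/(congr1 (fun x => x - cell_coord 0 u)); rewrite addrK subrr.
Qed.

Lemma cell_lower_coord (l : cell_poset D) (s t : cell_idx l) x :
  cell_lower l x -> cell_coord x (Tagged _ (s, t)) = 0.
Proof.
elim/lspan_ind: x / => [|x y Ex Ey|k x Ex|_ [mu [v [w [lt_mu ->]]]]].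
- exact: cell_coord0.
- by rewrite -[x]scale1r cell_coord_linear Ex Ey mulr0 addr0.
- by rewrite -[_ *: _]addr0 cell_coord_linear Ex cell_coord0 mulr0 addr0.
rewrite cell_coordC; case: eqP => // /(congr1 tag) /= E.
by rewrite E ltxx in lt_mu.
Qed.

Lemma cell_lower_free (l : cell_poset D) (t : cell_idx l)
    (c : cell_idx l -> K) :
  cell_lower l (\sum_s c s *: cellC s t) -> c =1 fun=> 0.
Proof.
move=> /cell_lower_coord low s; rewrite -(low s t).
transitivity (\sum_s' c s' * cell_coord (cellC s' t) (Tagged _ (s, t))).
  rewrite (bigD1 s) //= big1 ?addr0 => [|s' ns'].
    by rewrite cell_coordC eqxx mulr1.
  rewrite cell_coordC; case: eqP => [E|]; last by rewrite mulr0.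
  by case/eqP: ns'; have /eqP := E; rewrite eq_Tagged /= => /eqP[].
elim/big_rec2: _ => [|s' x y _ ->]; first by rewrite cell_coord0.
by rewrite cell_coord_linear.
Qed.

Lemma cell_coef_uniq (l : cell_poset D) a (s t : cell_idx l)
    (r : cell_idx l -> K) :
  cell_lower l (a * cellC s t - \sum_s' r s' *: cellC s' t) ->
  cell_coef a s =1 r.
Proof.
move=> low s'; apply/eqP; rewrite -subr_eq0; apply/eqP; move: s'.
apply: (@cell_lower_free _ t).
have := lspanD low (lspanZ (-1) (cell_coefP a s t)).
rewrite scaleN1r opprB addrC subrKA -sumrB.
by congr (cell_lower _ _); apply: eq_bigr => s' _; rewrite scalerBl.
Qed.

Lemma cell_lower_mul (l : cell_poset D) a x :
  cell_lower l x -> cell_lower l (a * x).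
Proof.
elim/lspan_ind: x / => [|x y Ex Ey|k x Ex|_ [mu [v [w [lt_mu ->]]]]].
- by rewrite mulr0; apply: lspan0.
- by rewrite mulrDr; apply: lspanD.
- by rewrite -scalerAr; apply: lspanZ.
rewrite -[a * _](subrK (\sum_v' cell_coef a v v' *: cellC v' w)).
apply: lspanD.
  elim/lspan_ind: _ / (cell_coefP a v w) => [|x y Ex Ey|k x Ex|].
  - exact: lspan0.
  - exact: lspanD.
  - exact: lspanZ.
  move=> _ [nu [v' [w' [lt_nu ->]]]]; apply: lspan_gen.
  by exists nu, v', w'; split=> //; apply: lt_trans lt_mu.
by apply: lspan_sum => v'; apply/lspanZ/lspan_gen; exists mu, v', w.
Qed.

Section CellModule.
Variable l : cell_poset D.

Let t0 : cell_idx l := xchoose (card_gt0P (cell_idx_gt0 l)).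

Fact cell_actA a b (w : cell_space l) :
  cell_act a (cell_act b w) = cell_act (a * b) w.
Proof.
have coefM (s : cell_idx l) : cell_coef (a * b) s =1
    fun s' => \sum_s1 cell_coef a s1 s' * cell_coef b s s1.
  apply: (@cell_coef_uniq _ _ _ t0).
  have := lspanD (cell_lower_mul a (cell_coefP b s t0))
    (lspan_sum (index_enum (cell_idx l))
       (fun s1 => lspanZ (cell_coef b s s1) (cell_coefP a s1 t0))).
  congr (cell_lower _ _); rewrite mulrBr mulrA mulr_sumr.
  rewrite -addrA; congr (_ + _).
  rewrite addrC -sumrB -sumrN.
  under eq_bigr => s1 _ do rewrite scalerBr -scalerAr addrAC subrr sub0r.
  rewrite !sumrN; congr (- _).
  under eq_bigr => s1 _ do rewrite scaler_sumr.
  rewrite exchange_big /=; apply: eq_bigr => s' _; rewrite scaler_suml.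
  by apply: eq_bigr => s1 _; rewrite scalerA mulrC.
apply/ffunP => s'; rewrite !ffunE.
under eq_bigr => s1 _ do rewrite ffunE mulr_sumr.
rewrite exchange_big /=; apply: eq_bigr => s _; rewrite coefM mulr_suml.
by apply: eq_bigr => s1 _; rewrite mulrA.
Qed.

Fact cell_act1 : left_id 1 (@cell_act l).
Proof.
move=> w.
have coef1 (s : cell_idx l) : cell_coef 1 s =1 fun s' => (s' == s)%:R.
  apply: (@cell_coef_uniq _ _ _ t0).
  rewrite (bigD1 s) //= big1 => [|s1 /negPf->]; last by rewrite scale0r.
  by rewrite eqxx scale1r addr0 mul1r subrr; apply: lspan0.
apply/ffunP => s'; rewrite ffunE (bigD1 s') //= big1 => [|s /negPf ns].
  by rewrite coef1 eqxx mul1r addr0.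
by rewrite coef1 eq_sym ns mul0r.
Qed.

Fact cell_actDr : right_distributive (@cell_act l) +%R.
Proof.
move=> a v w; apply/ffunP => s'; rewrite !ffunE -big_split /=.
by apply: eq_bigr => s _; rewrite ffunE mulrDr.
Qed.

Fact cell_actDl w : {morph (@cell_act l)^~ w : a b / a + b}.
Proof.
move=> a b; apply/ffunP => s'; rewrite !ffunE -big_split /=.
apply: eq_bigr => s _; rewrite -mulrDl; congr (_ * _).
have/(_ s') -> // : cell_coef (a + b) s =1
    fun s' => cell_coef a s s' + cell_coef b s s'.
apply: (@cell_coef_uniq _ _ _ t0).
have := lspanD (cell_coefP a s t0) (cell_coefP b s t0).
rewrite addrACA -opprD -mulrDl -big_split /=.
by congr (cell_lower _ (_ - _)); apply: eq_bigr => s1 _; rewrite scalerDl.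
Qed.

(* The same space, with [A] as the ring of scalars: [a *: w] is the action.   *)
Definition cell_module : Type := cell_space l.
HB.instance Definition _ := GRing.Zmodule.on cell_module.
HB.instance Definition _ := GRing.Zmodule_isLmodule.Build A cell_module
  cell_actA cell_act1 cell_actDr cell_actDl.

End CellModule.

Definition cell_support : {set cell_poset D} :=
  [set l | (fullv : {vspace cell_space l}) != 0%VS].

End Cellular.

(* Main.v *)
From HB Require Import structures.
Require Import Defs.
From mathcomp Require Import all_boot all_order all_algebra.
From mathcomp Require Import boolp reals complex.

(* The elements C_{s,t} act on W(l) through a symmetric form phi_l:           *)
(* C_{s,t} w = phi_l(t, w) C_s, and i(a) is the adjoint of a for phi_l. If w  *)
(* lies in the radical of phi_l, then b = sum_u w_u C_{u,t} satisfies         *)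
(* b a b in A(< l) for all a; since a semisimple ring is von Neumann regular, *)
(* b in A(< l) and w = 0. Nondegeneracy makes W(l) simple, and since          *)
(* C^mu_{s,t} kills W(l) unless l <= mu, the representation                   *)
(* A -> prod_l End(W(l)) is triangular with invertible diagonal blocks, hence *)
(* an isomorphism by equality of dimensions. Over an algebraically closed     *)
(* field W(l) has an orthonormal basis for phi_l, in which i is transposition *)
(* and L(A), the (-1)-eigenspace of i, is the product of the spaces of        *)
(* skew-symmetric matrices.                                                   *)

Set Implicit Arguments.
Unset Strict Implicit.
Unset Printing Implicit Defensive.
Import Order.TTheory GRing.Theory Num.Theory.
Local Open Scope ring_scope.

(** A semisimple cellular algebra is a product of full matrix algebras, one for each cell, and on
    each block i is the adjoint for a nondegenerate symmetric form. Over an algebraically closed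
    field of characteristic 0 such a form is a sum of squares, so i becomes transposition in a
    suitable basis and its (-1)-eigenspace L(A) becomes a sum of spaces of skew-symmetric matrices.

    Adjointness is [cell_gram_adj]. Semisimplicity enters through [cell_form_nondegenerate], on
    which everything else rests: simplicity of the cell modules ([cell_module_simple]), completeness
    of the list ([simple_module_cell]), and the product decomposition ([cell_rep_faithful],
    [cell_rep_surjective]). The orthonormal bases come from [symmetric_factor]. *)

Lemma module_isomorphic_sym (A : pzRingType) (V W : lmodType A) :
  module_isomorphic V W -> module_isomorphic W V.
Proof.
move=> [f [g fK gK]].
pose g_lin := GRing.isLinear.Build _ _ _ _ g (can2_linear fK gK).
pose g' : {linear W -> V} := HB.pack g g_lin.
by exists g'; exists f.
Qed.

(** * Submodules, complements and Schur's lemma *)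

Section SubmoduleClosed.
Variables (A : pzRingType) (V : lmodType A) (S : {pred V}).
Hypothesis closedS : submod_closed S.

Lemma submod_closed0 : 0 \in S.
Proof. by case: closedS. Qed.

Lemma submod_closedZ a v : v \in S -> a *: v \in S.
Proof.
by case: closedS => S0 SD Sv; rewrite -[_ *: _]addr0; apply: SD.
Qed.

Lemma submod_closedD v w : v \in S -> w \in S -> v + w \in S.
Proof.
by case: closedS => S0 SD Sv Sw; rewrite -[v]scale1r; apply: SD.
Qed.

Lemma submod_closed_sum (I : finType) (J : {set I}) (f : I -> V) :
  (forall i, f i \in S) -> \sum_(i in J) f i \in S.
Proof.
move=> fS; elim/big_rec: _ => [|i x _]; first exact: submod_closed0.
exact: submod_closedD.
Qed.

End SubmoduleClosed.

(** Take J maximal such that the sum of the S_j, j in J, meets N only in 0. By simplicity each S_j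
    either lies in N + [sumS J] or meets it in 0, and maximality of J settles the second case.
    Directness of the sum of the S_j is not assumed. *)
Lemma semisimple_complement (A : pzRingType) (V : lmodType A) (n : nat)
    (S : 'I_n -> {pred V}) (N : {pred V}) :
  (forall j, simple_submodule (S j)) ->
  (forall v, exists2 f : 'I_n -> V, forall j, f j \in S j & v = \sum_j f j) ->
  submod_closed N ->
  exists T : {pred V}, [/\ submod_closed T,
    forall v, v \in N -> v \in T -> v = 0
    & forall v, exists x y, [/\ x \in N, y \in T & v = x + y]].
Proof.
move=> simS spanS closedN; have closedS j : submod_closed (S j) by case: (simS j).
pose sumS (J : {set 'I_n}) : {pred V} := [pred v | `[< exists2 f : 'I_n -> V,
  forall j, f j \in S j & v = \sum_(j in J) f j >]].
have closed_sumS J : submod_closed (sumS J).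
  split=> [|a u v]; rewrite !inE.
    apply/asboolP; exists (fun=> 0); last by rewrite big1.
    by move=> j; apply: submod_closed0.
  move=> /asboolP[f fS ->] /asboolP[g gS ->].
  apply/asboolP; exists (fun j => a *: f j + g j).
    by move=> j; apply: submod_closedD => //; apply: submod_closedZ.
  by rewrite scaler_sumr -big_split.
pose meets0 (J : {set 'I_n}) := `[< forall v, v \in N -> v \in sumS J -> v = 0 >].
have [|J /maxsetP[/asboolP NJ0 maxJ]] := @ex_maxset _ meets0.
  by exists set0; apply/asboolP => v _; rewrite inE => /asboolP[f _]; rewrite big_set0.
pose NJ : {pred V} :=
  [pred v | `[< exists x y, [/\ x \in N, y \in sumS J & v = x + y] >]].
have closedNJ : submod_closed NJ.
  split=> [|a u v]; rewrite !inE.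
    apply/asboolP; exists 0, 0; rewrite addr0.
    by split=> //; apply: submod_closed0.
  move=> /asboolP[x [y [Nx Jy ->]]] /asboolP[x' [y' [Nx' Jy' ->]]].
  apply/asboolP; exists (a *: x + x'), (a *: y + y').
  rewrite scalerDr addrACA; split=> //.
    by apply: submod_closedD => //; apply: submod_closedZ.
  by apply: submod_closedD => //; apply: submod_closedZ.
have subS j : {subset S j <= NJ}.
  have [_ _ /(_ [pred v | (v \in S j) && (v \in NJ)])] := simS j.
  case=> [|v|U0|SU]; first split=> [|a u v].
  - by rewrite inE !submod_closed0.
  - move=> /andP[Su NJu] /andP[Sv NJv]; rewrite inE.
    by apply/andP; split; apply: submod_closedD => //; apply: submod_closedZ.
  - by case/andP.
  (* Here S_j meets N + [sumS J] only in 0, so adding j to J creates no intersection with N; by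
     maximality j was already in J. *)
  - suff jJ : j \in J.
      move=> v Sv; rewrite inE; apply/asboolP; exists 0, v; rewrite add0r.
      split=> //; first exact: submod_closed0.
      rewrite inE; apply/asboolP; exists (fun k => if k == j then v else 0).
        by move=> k; case: eqP => [->//|_]; apply: submod_closed0.
      by rewrite (bigD1 j) //= eqxx big1 ?addr0 // => k /andP[_ /negPf->].
    suff -> : J = j |: J by rewrite setU11.
    apply/esym/maxJ; last exact: subsetUr.
    apply/asboolP => v Nv; rewrite inE => /asboolP[f fS Ev].
    have [jJ|jJ] := boolP (j \in J).
      apply: NJ0 => //; rewrite inE; apply/asboolP; exists f => //.
      by rewrite Ev (setUidPr _) // sub1set.
    rewrite big_setU1 //= in Ev.
    have Jf : \sum_(i in J) f i \in sumS J by rewrite inE; apply/asboolP; exists f.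
    have fj0 : f j = 0.
      apply: U0; rewrite inE fS /=; apply/asboolP.
      exists v, (- \sum_(i in J) f i); split=> //; last by rewrite Ev addrK.
      by rewrite -scaleN1r; apply: submod_closedZ.
    by apply: NJ0; rewrite // Ev fj0 add0r.
  - by move=> v /SU /andP[].
exists (sumS J); split=> // v.
have [f fS ->] := spanS v.
suff : \sum_j f j \in NJ by rewrite inE => /asboolP.
have := submod_closed_sum closedNJ [set: 'I_n] (fun i => subS i _ (fS i)).
by under eq_bigl do rewrite inE.
Qed.

(* If [1 = a b + t] in [A = A b (+) T], then [b t = b - b a b] lies in both   *)
(* summands.                                                                  *)
Lemma semisimple_von_neumann_regular (A : pzRingType) :
  semisimple_ring A -> forall b : A, exists a : A, b = b * a * b.
Proof.
move=> [n [S [simS decS]]] b.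
have [||T [closedT NT0 NT]] :=
    @semisimple_complement _ _ _ S
      [pred x : A^o | `[< exists a : A, x = a * b >]] simS.
- by move=> v; have [f [[fS Ev] _]] := decS v; exists f.
- split=> [|a u v]; rewrite !inE.
    by apply/asboolP; exists 0; rewrite mul0r.
  move=> /asboolP[x ->] /asboolP[y ->]; apply/asboolP.
  by exists (a * x + y); rewrite mulrDl -mulrA.
have [x [t [/asboolP[a ->] Tt E1]]] := NT 1.
exists a; apply/eqP; rewrite -subr_eq0; apply/eqP/NT0.
  rewrite inE; apply/asboolP; exists (1 - b * a).
  by rewrite mulrBl mul1r.
suff -> : b - b * a * b = b *: t by apply: submod_closedZ.
have -> : t = 1 - a * b by rewrite E1 addrC addKr.
by rewrite /GRing.scale /= mulrBr mulr1 mulrA.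
Qed.

(** Schur's lemma: the kernel is a submodule other than V and the image a submodule other than 0. *)
Lemma simple_module_iso (A : pzRingType) (V W : lmodType A) (f : {linear V -> W}) :
  simple_module V -> simple_module W -> (exists v, f v != 0) ->
  module_isomorphic V W.
Proof.
move=> [_ _ simV] [_ _ simW] [v nz]; exists f.
have inj_f : injective f.
  apply: raddf_inj => x fx0.
  have [|//|ker0|kerV] := simV [pred x | f x == 0].
  - split=> [|a x1 x2]; rewrite !inE ?raddf0 //.
    by move=> /eqP f1 /eqP f2; rewrite linearP f1 f2 scaler0 addr0.
  - by apply: ker0; rewrite inE fx0.
  - by have := kerV v isT; rewrite inE (negPf nz).
have surj_f y : exists x, f x = y.
  have [|//|im0|imW] := simW [pred y | `[< exists x, f x = y >]].
  - split=> [|a y1 y2]; rewrite !inE.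
      by apply/asboolP; exists 0; rewrite raddf0.
    move=> /asboolP[x1 <-] /asboolP[x2 <-]; apply/asboolP.
    by exists (a *: x1 + x2); rewrite linearP.
  - by case/eqP: nz; apply: im0; rewrite inE; apply/asboolP; exists v.
  - by have /asboolP := imW y isT.
have [g gK] := choice surj_f.
by exists g => // x; apply: inj_f; rewrite gK.
Qed.

(** * The Gram form of a cell module *)

Section CellAction.
Variables (K : fieldType) (A : algType K) (D : cell_datum A).
Implicit Types (l mu : cell_poset D) (a b x : A).

Local Notation inv := (cell_inv D).
Local Notation index :=
  {l : cell_poset D & (cell_idx l * cell_idx l)%type}.
Local Notation gen u := (cellC (tagged u).1 (tagged u).2).
Local Notation ix s t :=
  (Tagged (fun l => cell_idx l * cell_idx l)%type (s, t) : index).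

Lemma cell_coordD a b u :
  cell_coord D (a + b) u = cell_coord D a u + cell_coord D b u.
Proof. by rewrite -[a]scale1r cell_coord_linear mul1r scale1r. Qed.

Lemma cell_coordZ k a u : cell_coord D (k *: a) u = k * cell_coord D a u.
Proof. by rewrite -[_ *: _]addr0 cell_coord_linear cell_coord0 addr0. Qed.

Lemma cell_coord_sum (I : finType) (k : I -> K) (x : I -> A) u :
  cell_coord D (\sum_i k i *: x i) u = \sum_i k i * cell_coord D (x i) u.
Proof.
elim/big_rec2: _ => [|i y z _ <-]; first exact: cell_coord0.
by rewrite cell_coord_linear.
Qed.

Lemma cell_coord_gen (u v : index) : cell_coord D (gen u) v = (u == v)%:R.
Proof. by case: u v => [l [s t]] [mu [v w]]; rewrite cell_coordC. Qed.

Lemma cell_coord_sumC l (k : cell_idx l -> K) (s t t' : cell_idx l) :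
  cell_coord D (\sum_s k s *: cellC s t) (ix s t') = k s * (t == t')%:R.
Proof.
rewrite cell_coord_sum (bigD1 s) //= big1 => [|s' ns]; last first.
  by rewrite cell_coordC eq_Tagged /= xpair_eqE (negPf ns) mulr0.
by rewrite cell_coordC eq_Tagged /= xpair_eqE eqxx addr0.
Qed.

Lemma cell_coord_sumCr l (k : cell_idx l -> K) (s t s' : cell_idx l) :
  cell_coord D (\sum_t k t *: cellC s t) (ix s' t) = (s == s')%:R * k t.
Proof.
rewrite cell_coord_sum (bigD1 t) //= big1 => [|t' nt]; last first.
  by rewrite cell_coordC eq_Tagged /= xpair_eqE (negPf nt) andbF mulr0.
by rewrite cell_coordC eq_Tagged /= xpair_eqE eqxx andbT addr0 mulrC.
Qed.

Lemma cell_lower_coord_lt l mu (s t : cell_idx l) x :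
  cell_lower mu x -> cell_coord D x (ix s t) != 0 -> (l < mu)%O.
Proof.
move=> low; have [//|nlt] := boolP (l < mu)%O.
rewrite (_ : cell_coord _ _ _ = 0) ?eqxx //.
elim/lspan_ind: x / low => [|x y Ex Ey|k x Ex|_ [nu [v [w [lt_nu ->]]]]].
- exact: cell_coord0.
- by rewrite cell_coordD Ex Ey addr0.
- by rewrite cell_coordZ Ex mulr0.
rewrite cell_coordC; case: eqP => // /(congr1 tag) /= E.
by rewrite -E lt_nu in nlt.
Qed.

Lemma cell_lower_inv l x : cell_lower l x -> cell_lower l (inv x).
Proof.
elim/lspan_ind: x / => [|x y Ex Ey|k x Ex|_ [mu [v [w [lt_mu ->]]]]].
- by rewrite raddf0; apply: lspan0.
- by rewrite raddfD; apply: lspanD.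
- by rewrite linearZ; apply: lspanZ.
by rewrite cell_invC; apply: lspan_gen; exists mu, w, v.
Qed.

(** The image of (C3) under i: right multiplication by a acts on the second index through i(a). *)
Lemma cell_mulCr l (s t : cell_idx l) a :
  cell_lower l (cellC s t * a - \sum_t' cell_coef (inv a) t t' *: cellC s t').
Proof.
have := cell_lower_inv (cell_coefP (inv a) t s).
rewrite raddfB /= anti_invM anti_invK cell_invC raddf_sum /=.
by under eq_bigr do rewrite linearZ /= cell_invC.
Qed.

(** Turns the chosen scalars r_a(s',s) into coordinates of a product, with t free; linearity in a
    follows at once. *)
Lemma cell_coefE l (s s' t : cell_idx l) a :
  cell_coef a s s' = cell_coord D (a * cellC s t) (ix s' t).
Proof.
have := cell_lower_coord s' t (cell_coefP a s t).
rewrite -scaleN1r cell_coordD cell_coordZ cell_coord_sumC eqxx mulr1 mulN1r.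
by move/eqP; rewrite subr_eq0 eq_sym => /eqP.
Qed.

Lemma cell_coef_sum l (I : finType) (k : I -> K) (x : I -> A)
    (s s' : cell_idx l) :
  cell_coef (\sum_i k i *: x i) s s' = \sum_i k i * cell_coef (x i) s s'.
Proof.
rewrite (cell_coefE s s' s) mulr_suml.
under eq_bigr do rewrite -scalerAl.
by rewrite cell_coord_sum; apply: eq_bigr => i _; rewrite -cell_coefE.
Qed.

Lemma cell_coef_linear l k a b (s s' : cell_idx l) :
  cell_coef (k *: a + b) s s' = k * cell_coef a s s' + cell_coef b s s'.
Proof. by rewrite !(cell_coefE s s' s) mulrDl -scalerAl cell_coord_linear. Qed.

Lemma cell_coefM l a b (s s' : cell_idx l) :
  cell_coef (a * b) s s' = \sum_u cell_coef a u s' * cell_coef b s u.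
Proof.
have act_delta c u : cell_act c [ffun v => (v == s)%:R] u = cell_coef c s u.
  rewrite ffunE (bigD1 s) //= big1 => [|v /negPf nv].
    by rewrite ffunE eqxx mulr1 addr0.
  by rewrite ffunE nv mulr0.
rewrite -act_delta -cell_actA ffunE.
by apply: eq_bigr => u _; rewrite act_delta.
Qed.

(** A(< l) is a left ideal stable under i, hence also a right ideal, so x C_{s,s} has no coordinate
    in layer l. *)
Lemma cell_coef_lower l x (s s' : cell_idx l) :
  cell_lower l x -> cell_coef x s s' = 0.
Proof.
move=> low; rewrite (cell_coefE s s' s) -[x](anti_invK inv).
rewrite -[cellC s s]cell_invC -anti_invM.
by apply/cell_lower_coord/cell_lower_inv/cell_lower_mul/cell_lower_inv.
Qed.

(** By the right-hand form of (C3), C^mu_{v,w} C^l_{s,s} lies in the span of the C^mu_{v,t'} plus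
    A(< mu); a nonzero coordinate in layer l forces l = mu or l < mu. *)
Lemma cell_coefC_le l mu (v w : cell_idx mu) (s s' : cell_idx l) :
  cell_coef (cellC v w : A) s s' != 0 -> (l <= mu)%O.
Proof.
rewrite (cell_coefE s s' s) => nz; rewrite le_eqVlt; apply/orP.
have [|ne] := boolP (l == mu); [by left|right].
have low := cell_mulCr v w (cellC s s).
apply: (cell_lower_coord_lt low (s := s') (t := s)).
rewrite -scaleN1r cell_coordD cell_coordZ cell_coord_sum big1 ?mulr0 ?addr0 // => i _.
rewrite cell_coordC; case: eqP => [/(congr1 tag) /= E|]; last by rewrite mulr0.
by case/eqP: ne.
Qed.

(** The value phi_l(C_t, C_u), read off from C_{t,t} C_u = phi_l(C_t, C_u) C_t. By [cell_coefC] any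
    C_{s,t} in place of C_{t,t} gives the same scalar. *)
Definition cell_gram l (t u : cell_idx l) : K := cell_coef (cellC t t) u t.

Lemma cell_coefC l (s t u s' : cell_idx l) :
  cell_coef (cellC s t) u s' = (s == s')%:R * cell_gram t u.
Proof.
(* Both sides are the (w, v) coordinate of C_{x,y} C_{z,v}, expanded by the left and by the right
   form of (C3). *)
have key (x y z v w : cell_idx l) : cell_coef (cellC x y) z w =
    (x == w)%:R * cell_coef (cellC v z) y v.
  have := cell_lower_coord w v (cell_mulCr x y (cellC z v)).
  rewrite -scaleN1r cell_coordD cell_coordZ -cell_coefE cell_invC.
  rewrite cell_coord_sumCr mulN1r.
  by move/eqP; rewrite subr_eq0 => /eqP.
rewrite (key _ _ _ u) /cell_gram; congr (_ * _).
by rewrite (key t t u u) eqxx mul1r.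
Qed.

Lemma cell_gramC l (t u : cell_idx l) : cell_gram t u = cell_gram u t.
Proof.
rewrite {1}/cell_gram.
have := cell_lower_coord t u (cell_mulCr t t (cellC u u)).
rewrite -scaleN1r cell_coordD cell_coordZ -cell_coefE cell_invC.
rewrite cell_coord_sumCr eqxx mul1r mulN1r.
by move/eqP; rewrite subr_eq0 => /eqP.
Qed.

(** This is phi_l(C_s, a C_u) = phi_l(i(a) C_s, C_u): expand C_{s,s} a by [cell_mulCr], let it act
    on C_u and compare the coefficients of C_s. *)
Lemma cell_gram_adj l a (s u : cell_idx l) :
  \sum_v cell_gram s v * cell_coef a u v =
  \sum_v cell_coef (inv a) s v * cell_gram v u.
Proof.
have : cell_coef (cellC s s * a - \sum_v cell_coef (inv a) s v *: cellC s v) u s = 0.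
  exact/cell_coef_lower/cell_mulCr.
rewrite -scaleN1r addrC cell_coef_linear cell_coefM cell_coef_sum mulN1r addrC.
move/eqP; rewrite subr_eq0 => /eqP.
under [LHS]eq_bigr do rewrite cell_coefC eqxx mul1r.
by under [RHS]eq_bigr do rewrite cell_coefC eqxx mul1r.
Qed.

Definition cell_form l (t : cell_idx l) (w : cell_space l) : K :=
  \sum_u cell_gram t u * w u.

Lemma cell_form_act l a (t : cell_idx l) (w : cell_space l) :
  cell_form t (cell_act a w) = \sum_v cell_coef (inv a) t v * cell_form v w.
Proof.
rewrite /cell_form; under eq_bigr do rewrite ffunE mulr_sumr.
rewrite exchange_big /=.
under eq_bigr => s _.
  under eq_bigr do rewrite mulrA.
  rewrite -mulr_suml cell_gram_adj mulr_suml.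
  under eq_bigr do rewrite -mulrA.
  over.
by rewrite exchange_big /=; apply: eq_bigr => v _; rewrite mulr_sumr.
Qed.

Lemma cell_actC l (s t u : cell_idx l) (w : cell_space l) :
  cell_act (cellC s t) w u = (s == u)%:R * cell_form t w.
Proof.
rewrite ffunE mulr_sumr; apply: eq_bigr => v _.
by rewrite cell_coefC mulrA.
Qed.

Lemma cell_act_sum l (I : finType) (k : I -> K) (x : I -> A) (w : cell_space l) u :
  cell_act (\sum_i k i *: x i) w u = \sum_i k i * cell_act (x i) w u.
Proof.
rewrite ffunE; under eq_bigr do rewrite cell_coef_sum mulr_suml.
rewrite exchange_big; apply: eq_bigr => i _; rewrite ffunE mulr_sumr.
by apply: eq_bigr => s _; rewrite mulrA.
Qed.

Hypothesis ssA : semisimple_ring A.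

Lemma cell_form_nondegenerate l (x : cell_space l) :
  (forall t, cell_form t x = 0) -> x = 0.
Proof.
move=> x0; apply/ffunP => t; pose b := \sum_u x u *: cellC u t : A.
(* Column t of layer l in c b is the vector c x. With c = 1 this recovers x; with c = b a it is b (a
   x), which will vanish. *)
have coord_mul c u : cell_coord D (c * b) (ix u t) = cell_act c x u.
  rewrite /b mulr_sumr; under eq_bigr do rewrite -scalerAr.
  rewrite cell_coord_sum ffunE; apply: eq_bigr => v _.
  by rewrite -cell_coefE mulrC.
have [a Eb] := semisimple_von_neumann_regular ssA b.
have := coord_mul 1 t; rewrite mul1r cell_act1 => <-.
rewrite Eb coord_mul -cell_actA.
(* The radical of the form is a submodule, by adjointness. *)
have form0 u : cell_form u (cell_act a x) = 0.
  by rewrite cell_form_act big1 // => v _; rewrite x0 mulr0.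
rewrite cell_act_sum big1 ?ffunE // => u _.
by rewrite cell_actC form0 !mulr0.
Qed.

Lemma cell_form_neq0 l (w : cell_space l) :
  w != 0 -> exists t, cell_form t w != 0.
Proof.
move=> nz; apply/existsP; apply: contraNT nz => /existsPn w0.
by apply/eqP/cell_form_nondegenerate => t; apply/eqP/negbNE/w0.
Qed.

Lemma cell_module_simple l : simple_module (cell_module l).
Proof.
split=> //.
  have /card_gt0P[s _] := cell_idx_gt0 l.
  exists [ffun u => (u == s)%:R] => //; apply/eqP => /ffunP/(_ s).
  by rewrite !ffunE eqxx => /eqP; rewrite oner_eq0.
move=> T closedT _.
have [T0|] := pselect {in T, forall v, v = 0}; [by left|move=> nT0; right => v _].
have [w Tw nzw] : exists2 w, w \in T & w != 0.
  apply: contrapT => nT; apply: nT0 => w Tw; apply/eqP; apply: contrapT => /negP nz.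
  by apply: nT; exists w.
have [t nzt] := cell_form_neq0 nzw.
(* Since C_{s,t} w = phi_l(C_t, w) C_s, this element sends w to v; so every nonzero vector generates
   the module. *)
pose a : A := \sum_s (v s / cell_form t w) *: cellC s t.
suff -> : v = a *: w by apply: (submod_closedZ closedT).
apply/ffunP => u; rewrite [RHS]cell_act_sum (bigD1 u) //= big1 => [|s /negPf ns].
  by rewrite cell_actC eqxx mul1r addr0 divfK.
by rewrite cell_actC ns mul0r mulr0.
Qed.

(** Some C^l_{s,t} acts nontrivially on W(l), hence on the isomorphic W(mu), and [cell_coefC_le]
    applies. *)
Lemma cell_module_iso_le l mu :
  module_isomorphic (cell_module l) (cell_module mu) -> (mu <= l)%O.
Proof.
move=> [f [g fK gK]].
have /card_gt0P[s _] := cell_idx_gt0 l.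
pose w : cell_module l := [ffun u => (u == s)%:R].
have [|t nzt] := @cell_form_neq0 l w.
  apply/eqP => /ffunP/(_ s).
  by rewrite !ffunE eqxx => /eqP; rewrite oner_eq0.
have nza : (cellC s t : A) *: w != 0.
  apply/eqP => /ffunP/(_ s); rewrite [LHS]cell_actC eqxx mul1r ffunE => /eqP.
  exact/negP.
apply: contrapT => /negP nle; case/eqP: nza; apply: (can_inj fK).
rewrite linear0 linearZ /=; apply/ffunP => u; rewrite !ffunE big1 // => v _.
apply/eqP; rewrite mulf_eq0; apply/orP; left.
by apply: contraNT nle => /cell_coefC_le.
Qed.

Lemma cell_module_iso_eq l mu :
  module_isomorphic (cell_module l) (cell_module mu) -> l = mu.
Proof.
move=> iso; apply/le_anti; rewrite (cell_module_iso_le iso) andbT.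
exact/cell_module_iso_le/module_isomorphic_sym.
Qed.

End CellAction.

(** * Classification of the simple modules, and A as a product of matrix algebras *)

Lemma finporder_lt_ind (d : Order.disp_t) (T : finPOrderType d) (P : T -> Prop) :
  (forall x, (forall y, (y < x)%O -> P y) -> P x) -> forall x, P x.
Proof.
move=> IH x; have [n] := ubnP #|[set y | (y < x)%O]|.
elim: n x => // n IHn x; rewrite ltnS => le_n; apply: IH => y lt_yx.
apply: IHn; apply: leq_trans le_n; apply: proper_card.
apply/properP; split; last by exists y; rewrite !inE ?ltxx.
by apply/subsetP => z; rewrite !inE => /lt_trans; apply.
Qed.

Lemma finporder_gt_ind (d : Order.disp_t) (T : finPOrderType d) (P : T -> Prop) :
  (forall x, (forall y, (x < y)%O -> P y) -> P x) -> forall x, P x.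
Proof. exact: (@finporder_lt_ind _ T^d). Qed.

Section SemisimpleCellular.
Variables (K : fieldType) (A : algType K) (D : cell_datum A).
Hypothesis ssA : semisimple_ring A.
Implicit Types (l mu : cell_poset D) (a b x : A).

Local Notation inv := (cell_inv D).
Local Notation index :=
  {l : cell_poset D & (cell_idx l * cell_idx l)%type}.
Local Notation gen u := (cellC (tagged u).1 (tagged u).2).
Local Notation ix s t :=
  (Tagged (fun l => cell_idx l * cell_idx l)%type (s, t) : index).

(** If V is isomorphic to no W(l), then by induction up the order every C^l_{s,t} kills V, and so
    does 1. *)
Lemma simple_module_cell (V : lmodType A) :
  simple_module V -> exists l, module_isomorphic V (cell_module l).
Proof.
move=> simV; apply: contrapT => /forallNP niso.
have actZ k a (v : V) : (k *: a) *: v = k%:A *: (a *: v).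
  by rewrite scalerA mulr_algl.
have act0 l : forall (s t : cell_idx l) (v : V), (cellC s t : A) *: v = 0.
  elim/finporder_lt_ind: l => l low0 s t v.
  have lower0 x : cell_lower l x -> x *: v = 0.
    elim/lspan_ind: x / => [|x y Ex Ey|k x Ex|_ [mu [s' [t' [lt_mu ->]]]]].
    - by rewrite scale0r.
    - by rewrite scalerDl Ex Ey addr0.
    - by rewrite actZ Ex scaler0.
    - exact: low0.
  (* [elt] is A-linear modulo A(< l), which kills V by induction. So w |-> elt(w) v is a module map
     W(l) -> V with C_s |-> C_{s,t} v; were it nonzero, Schur's lemma would give an isomorphism. *)
  pose elt (w : cell_module l) : A := \sum_u w u *: cellC u t.
  have eltD w1 w2 : elt (w1 + w2) = elt w1 + elt w2.
    by rewrite -big_split; apply: eq_bigr => u _; rewrite ffunE scalerDl.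
  have elt_act a w : cell_lower l (a * elt w - elt (a *: w)).
    have := lspan_sum (index_enum (cell_idx l))
      (fun u => lspanZ (w u) (cell_coefP a u t)).
    rewrite /cell_lower; congr (lspan _ _); rewrite /elt mulr_sumr.
    under eq_bigr do rewrite scalerBr scalerAr.
    rewrite sumrB; congr (_ - _).
    under eq_bigr do rewrite scaler_sumr.
    rewrite exchange_big; apply: eq_bigr => u' _; rewrite ffunE scaler_suml.
    by apply: eq_bigr => u _; rewrite scalerA mulrC.
  pose f w : V := elt w *: v.
  have f_lin : linear f.
    move=> a w1 w2; rewrite /f eltD scalerDl scalerA; congr (_ + _).
    by apply/esym/eqP; rewrite -subr_eq0 -scalerBl lower0.
  pose f' : {linear cell_module l -> V} :=
    HB.pack f (GRing.isLinear.Build _ _ _ _ f f_lin).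
  apply: contrapT => nz; apply: (niso l); apply: module_isomorphic_sym.
  apply: (simple_module_iso (f := f')) => //; first exact: cell_module_simple.
  exists [ffun u => (u == s)%:R] => /=; apply/eqP; rewrite /f /elt (bigD1 s) //=.
  rewrite big1 => [|u /negPf nu]; last by rewrite ffunE nu scale0r.
  by rewrite ffunE eqxx scale1r addr0.
have [_ [v _ /eqP nzv] _] := simV; case: nzv.
rewrite -[v]scale1r (cell_coordP D 1) scaler_suml big1 // => u _.
by rewrite actZ act0 scaler0.
Qed.

(** Induction down the order: on W(l) only layers mu >= l act, and those above l already have zero
    coordinates, so layer l alone acts there. *)
Lemma cell_rep_faithful a :
  (forall l (s s' : cell_idx l), cell_coef a s s' = 0) -> a = 0.
Proof.
move=> a0.
have coord0 l : forall s t : cell_idx l, cell_coord D a (ix s t) = 0.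
  elim/finporder_gt_ind: l => l up0 s t.
  (* Row s of layer l lies in the radical: its product with C_u under the form is the coefficient of
     C_s in a C_u. *)
  suff /ffunP/(_ t) : [ffun v => cell_coord D a (ix s v)] = 0 :> cell_space l.
    by rewrite !ffunE.
  apply: (cell_form_nondegenerate ssA) => u; rewrite -[RHS](a0 l u s).
  rewrite {2}(cell_coordP D a) cell_coef_sum.
  transitivity (\sum_m \sum_(p : cell_idx m * cell_idx m)
      cell_coord D a (ix p.1 p.2) * cell_coef (cellC p.1 p.2 : A) u s); last first.
    by rewrite sig_big_dep; apply: eq_bigr => -[m [v w]] _.
  rewrite (bigD1 l) //= [X in _ + X]big1 => [|mu ne]; last first.
    rewrite big1 // => p _; have [le_lm|nle] := boolP (l <= mu)%O.
      case: p => v w; rewrite up0 ?mul0r // lt_neqAle le_lm.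
      by rewrite eq_sym ne.
    have [->|/cell_coefC_le le_lm] := eqVneq (cell_coef (cellC p.1 p.2 : A) u s) 0.
      by rewrite mulr0.
    by rewrite le_lm in nle.
  rewrite addr0 -(pair_bigA _ (fun v w => cell_coord D a (ix v w) *
    cell_coef (cellC v w : A) u s)) (bigD1 s) //= [X in _ + X]big1 => [|v /negPf nv].
    rewrite addr0; apply: eq_bigr => w _.
    by rewrite cell_coefC eqxx mul1r ffunE mulrC cell_gramC.
  by rewrite big1 // => w _; rewrite cell_coefC nv mul0r mulr0.
rewrite (cell_coordP D a) big1 // => -[l [s t]] _.
by rewrite coord0 scale0r.
Qed.

(** [index] labels both the basis of A and the matrix entries of all blocks, so the matrix [N] of
    the representation is square; faithfulness makes it invertible. *)
Lemma cell_rep_surjective (Y : forall l, cell_idx l -> cell_idx l -> K) :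
  exists a, forall l (s s' : cell_idx l), cell_coef a s s' = Y l s s'.
Proof.
pose N : 'M[K]_#|{: index}| := \matrix_(i, j)
  cell_coef (gen (enum_val i) : A) (tagged (enum_val j)).1 (tagged (enum_val j)).2.
pose el (c : 'rV[K]_#|{: index}|) : A := \sum_i c 0 i *: gen (enum_val i).
have mulN c j : (c *m N) 0 j =
    cell_coef (el c) (tagged (enum_val j)).1 (tagged (enum_val j)).2.
  by rewrite mxE cell_coef_sum; apply: eq_bigr => i _; rewrite mxE.
have unitN : N \in unitmx.
  rewrite -row_free_unit; apply: inj_row_free => c cN0.
  have el0 : el c = 0.
    apply: cell_rep_faithful => l s s'.
    by have := mulN c (enum_rank (ix s s')); rewrite enum_rankK cN0 mxE.
  apply/rowP => i; rewrite mxE.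
  have := cell_coord0 (enum_val i); rewrite -el0 cell_coord_sum (bigD1 i) //=.
  rewrite cell_coord_gen eqxx mulr1 big1 ?addr0 // => j /negPf nj.
  by rewrite cell_coord_gen (inj_eq enum_val_inj) nj mulr0.
pose y : 'rV[K]_#|{: index}| :=
  \row_j Y _ (tagged (enum_val j)).1 (tagged (enum_val j)).2.
exists (el (y *m invmx N)) => l s s'.
have := mulN (y *m invmx N) (enum_rank (ix s s')).
by rewrite mulmxKV // mxE enum_rankK.
Qed.

End SemisimpleCellular.

(** * Symmetric matrices as sums of squares *)

(** Polarization: isotropy of e_i + e_j gives 2 G_ij = 0. *)
Lemma symmetric_isotropic_eq0 (F : fieldType) (n : nat) (G : 'M[F]_n) :
  (2%:R : F) != 0 -> G^T = G -> (forall v : 'rV_n, v *m G *m v^T = 0) -> G = 0.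
Proof.
move=> nz2 symG iso.
have bil i j :
    delta_mx 0 i *m G *m (delta_mx 0 j)^T = (G i j)%:M :> 'M_1.
  by rewrite -rowE trmx_delta -colE; apply/matrixP => ? ?; rewrite !ord1 !mxE eqxx.
apply/matrixP => i j; rewrite [RHS]mxE.
have := iso (delta_mx 0 i + delta_mx 0 j).
have symij : G j i = G i j by rewrite -[in LHS]symG mxE.
rewrite linearD /= !(mulmxDl, mulmxDr) !iso add0r addr0 !bil.
move=> /matrixP/(_ 0 0); rewrite !mxE /= !mulr1n symij -mulr2n -mulr_natl => /eqP.
by rewrite mulf_eq0 (negPf nz2) => /eqP.
Qed.

(* Rank-one reduction: if [c = v G v^T != 0], then [G - (v G)^T (v G) / c]    *)
(* has smaller rank.                                                          *)
Lemma symmetric_factor (C : numClosedFieldType) (n r : nat) (G : 'M[C]_n) :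
  G^T = G -> (\rank G <= r)%N -> exists P : 'M[C]_(r, n), G = P^T *m P.
Proof.
elim: r G => [|r IH] G symG rkG.
  exists 0; rewrite mulmx0; apply/eqP; rewrite -mxrank_eq0; by case: (\rank G) rkG.
have [->|nzG] := eqVneq G 0; first by exists 0; rewrite mulmx0.
have [v nzv] : exists v : 'rV_n, v *m G *m v^T != 0.
  apply: contrapT => /forallNP iso; case/eqP: nzG.
  apply: symmetric_isotropic_eq0 => // [|v]; first by rewrite pnatr_eq0.
  by apply/eqP; apply: contrapT => /negP; apply: iso.
pose c := (v *m G *m v^T) 0 0.
have nzc : c != 0.
  by apply: contraNneq nzv => c0; apply/eqP/matrixP => i j; rewrite !ord1 [LHS]c0 mxE.
pose w := (sqrtC c)^-1 *: (v *m G).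
have ww : w^T *m w = c^-1 *: ((v *m G)^T *m (v *m G)).
  by rewrite /w linearZ /= linearZ -scalemxAl scalerA -expr2 exprVn sqrtCK.
have [||P EP] := IH (G - w^T *m w).
- by rewrite linearB /= trmx_mul trmxK symG.
- rewrite -ltnS; apply: leq_trans rkG; apply: rank_ltmx; rewrite ltmxE.
  apply/andP; split.
    by rewrite addmx_sub // eqmx_opp ww scalemx_sub // mulmxA submxMl.
  (* The rank drops strictly because the reduced matrix kills v^T: were G = X (G - w^T w), then v G
     v^T would be 0. *)
  apply/negP => /submxP[X EX]; case/eqP: nzv.
  have -> : v *m G *m v^T = v *m X *m ((G - w^T *m w) *m v^T).
    by rewrite {1}EX !mulmxA.
  rewrite mulmxBl ww -!scalemxAl trmx_mul symG -!mulmxA.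
  have -> : v *m (G *m v^T) = c%:M by rewrite mulmxA [LHS]mx11_scalar.
  by rewrite mul_mx_scalar -scalemxAr scalerA mulVf // scale1r subrr !mulmx0.
suff E : G = (col_mx w P)^T *m col_mx w P by exists (col_mx w P).
by rewrite tr_col_mx mul_row_col -EP addrC subrK.
Qed.

(** * Orthonormal bases and the Plesken Lie algebra *)

Section CellSpace.
Variables (K : fieldType) (A : algType K) (D : cell_datum A) (l : cell_poset D).

Lemma dim_cell_space : \dim (fullv : {vspace cell_space l}) = #|cell_idx l|.
Proof. by rewrite dimvf /dim /= muln1. Qed.

Lemma mem_cell_support : l \in cell_support D.
Proof. by rewrite inE -dimv_eq0 dim_cell_space -lt0n cell_idx_gt0. Qed.

End CellSpace.

Section Plesken.
Variables (C : numClosedFieldType) (A : algType C) (D : cell_datum A).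
Hypothesis ssA : semisimple_ring A.
Local Notation inv := (cell_inv D).

(* With [G = P^T P] the Gram matrix and [R a] the matrix of [a] on W(l), take *)
(* [X a = P (R a) P^-1].                                                      *)
Lemma cell_orthogonal_rep (l : cell_poset D) (r : nat) : r = #|cell_idx l| ->
  exists (X : {linear A -> 'M[C]_r}) (Z : 'M_r -> cell_idx l -> cell_idx l -> C),
    [/\ {morph X : a b / a * b >-> a *m b}, forall a, X (inv a) = (X a)^T
      & forall a Y, X a = Y <-> forall s s', cell_coef a s s' = Z Y s s'].
Proof.
move=> Er; pose n := #|cell_idx l|.
pose G : 'M[C]_n := \matrix_(i, j) cell_gram (enum_val i) (enum_val j).
pose R a : 'M[C]_n := \matrix_(i, j) cell_coef a (enum_val j) (enum_val i).
have sum_enum (F : cell_idx l -> C) : \sum_s F s = \sum_(i < n) F (enum_val i).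
  rewrite (reindex_onto enum_val enum_rank) /= => [|s _]; rewrite ?enum_rankK //.
  by apply: eq_bigl => i; rewrite enum_valK eqxx.
have symG : G^T = G by apply/matrixP => i j; rewrite !mxE cell_gramC.
have RM a b : R (a * b) = R a *m R b.
  apply/matrixP => i j; rewrite !mxE cell_coefM sum_enum.
  by under [RHS]eq_bigr do rewrite !mxE.
have adjR a : G *m R a = (R (inv a))^T *m G.
  apply/matrixP => i j; rewrite !mxE.
  have := cell_gram_adj a (enum_val i) (enum_val j); rewrite !sum_enum => E.
  under [LHS]eq_bigr do rewrite !mxE.
  by under [RHS]eq_bigr do rewrite !mxE.
have unitG : G \in unitmx.
  rewrite -unitmx_tr -row_free_unit; apply: inj_row_free => v vG0.
  have: [ffun s => v 0 (enum_rank s)] = 0 :> cell_space l.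
    apply: (cell_form_nondegenerate ssA) => t; rewrite /cell_form sum_enum.
    have := congr1 (fun M : 'rV_n => M 0 (enum_rank t)) vG0.
    rewrite !mxE => E; rewrite -[RHS]E; apply: eq_bigr => k _.
    by rewrite !mxE ffunE enum_valK enum_rankK mulrC.
  move/ffunP => v0; apply/rowP => i; have := v0 (enum_val i).
  by rewrite !ffunE enum_valK mxE.
have [P EP] : exists P : 'M[C]_(r, n), G = P^T *m P.
  by apply: symmetric_factor => //; rewrite Er rank_leq_row.
have [Q EQ] : {Q | Q = invmx G *m P^T} by exists (invmx G *m P^T).
have QP : Q *m P = 1%:M by rewrite EQ -mulmxA -EP mulVmx.
have PQ : P *m Q = 1%:M by move: P Q QP {EP EQ}; rewrite Er => P Q /mulmx1C.
pose X a : 'M_r := P *m R a *m Q.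
have X_lin : linear X.
  move=> k a b; rewrite /X scalemxAl scalemxAr -mulmxDl -mulmxDr; congr (_ *m _ *m _).
  by apply/matrixP => i j; rewrite !mxE cell_coef_linear.
(* Y transported back to the basis C_s. The indices are swapped because [cell_coef a s s'] is the
   entry in row s' and column s. *)
pose Z (Y : 'M_r) s s' := (Q *m Y *m P) (enum_rank s') (enum_rank s).
pose X' : {linear A -> 'M[C]_r} := HB.pack X (GRing.isLinear.Build _ _ _ _ X X_lin).
exists X', Z; split=> [a b|a|a Y] /=.
- by rewrite /X RM !mulmxA -(mulmxA _ Q P) QP mulmx1.
- rewrite /X EQ !trmx_mul trmxK trmx_inv symG.
  have -> : (R a)^T = G *m R (inv a) *m invmx G.
    by rewrite adjR anti_invK mulmxK.
  by rewrite !mulmxA mulmxKV.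
split=> [<- s s'|E].
  rewrite /Z /X !mulmxA QP mul1mx -mulmxA QP mulmx1 mxE.
  by rewrite !enum_rankK.
have -> : X a = P *m (Q *m Y *m P) *m Q.
  congr (_ *m _ *m _); apply/matrixP => i j.
  by rewrite mxE E /Z !enum_valK.
by rewrite !mulmxA PQ mul1mx -mulmxA PQ mulmx1.
Qed.

Lemma plesken_orthogonal_isomorphic :
  lie_isomorphic (plesken_lie_algebra inv)
    (lie_dsum (fun l : {l : cell_poset D | l \in cell_support D} =>
       orthogonal_lie C (\dim (fullv : {vspace cell_space (val l)})))).
Proof.
pose m (l : cell_poset D) := \dim (fullv : {vspace cell_space l}).
pose X l := sval (cid (cell_orthogonal_rep (dim_cell_space l))).
pose Z l := sval (cid (svalP (cid (cell_orthogonal_rep (dim_cell_space l))))).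
have XZ l := svalP (cid (svalP (cid (cell_orthogonal_rep (dim_cell_space l))))).
have XM l : {morph X l : a b / a * b >-> a *m b} by case: (XZ l).
have Xinv l a : X l (inv a) = (X l a)^T by case: (XZ l).
have XE l a Y : X l a = Y <-> forall s s', cell_coef a s s' = Z l Y s s'.
  by case: (XZ l).
clear XZ; clearbody X Z.
have X_inj a b : (forall l, X l a = X l b) -> a = b.
  move=> Eab; apply/eqP; rewrite -subr_eq0; apply/eqP/(cell_rep_faithful ssA) => l s s'.
  (* Through [XE], equal images mean equal coefficients, so a - b has the coefficients of 0. *)
  have /XE E0 : X l 0 = X l 0 by [].
  have /XE -> : X l (a - b) = X l 0 by rewrite raddfB /= Eab subrr raddf0.
  by rewrite -E0; apply/cell_coef_lower/lspan0.
pose L : lieAlgType C := plesken_lie_algebra inv.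
have inv_val (x : L) : inv (val x) = - (val x : A).
  by apply: plesken_lspanP; have := valP x; rewrite inE => /asboolP.
have skewX l (x : L) : X l (val x) \in @skew_pred C (m l).
  by rewrite inE /= -Xinv inv_val raddfN.
pose I := {l : cell_poset D | l \in cell_support D}.
pose T : lieAlgType C := lie_dsum (fun l : I => orthogonal_lie C (m (val l))).
pose f0 (x : L) : T :=
  finfun (fun l : I => Sub (X (val l) (val x)) (skewX (val l) x)
    : orthogonal_lie C (m (val l))).
have f0E x l : val (f0 x l) = X (val l) (val x) by rewrite ffunE SubK.
have f0_lin : linear f0.
  move=> k x y; apply/ffunP => l; apply: val_inj; rewrite f0E.
  have -> : (k *: f0 x + f0 y) l = k *: f0 x l + f0 y l.
    by rewrite [LHS]ffunE; congr (_ + _); rewrite [LHS]ffunE.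
  by rewrite [RHS]linearP /= !f0E !linearP.
pose f : {linear L -> T} :=
  HB.pack f0 (GRing.isLinear.Build _ _ _ _ f0 f0_lin).
exists f.
  have f_inj : injective f.
    move=> x y Exy; apply/val_inj/X_inj => l.
    have fl x' : val ((f x' : T) (exist _ l (mem_cell_support l))) = X l (val x').
      exact: f0E.
    by rewrite -!fl Exy.
  have f_surj y : exists x, f x = y.
    have mem l : l \in cell_support D := mem_cell_support l.
    pose Y l : 'M[C]_(m l) := val (y (exist _ l (mem l))).
    have [a Ea] := cell_rep_surjective ssA (fun l => Z l (Y l)).
    have XY l : X l a = Y l by apply/XE.
    (* All blocks of i(a) and -a agree because each Y_l is skew-symmetric, and the blocks determine
       the element. *)
    have inva : inv a = - a.
      apply: X_inj => l; rewrite Xinv raddfN /= XY; apply/eqP.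
      exact: valP (y (exist _ l (mem l))).
    have aL : (a : comm_lie A) \in plesken_pred inv.
      rewrite inE; apply/asboolP.
      (* The (-1)-eigenspace of i lies in L(A), as 2 is invertible. *)
      have -> : a = 2%:R^-1 *: (a - inv a).
        by rewrite inva opprK -mulr2n -scaler_nat scalerA mulVf ?scale1r ?pnatr_eq0.
      by apply/lspanZ/lspan_gen; exists a.
    exists (Sub a aL : L); apply/ffunP => -[l sl]; apply: val_inj.
    have -> : val ((f (Sub a aL : L) : T) (exist _ l sl)) = X l a by exact: f0E.
    by rewrite [LHS]XY /Y (bool_irrelevance (mem l) sl).
  have [g gK] := choice f_surj.
  by exists g => // x; apply: f_inj; rewrite gK.
move=> x y; apply/ffunP => l; apply: val_inj.
have -> : (lie (f x) (f y) : T) l = lie (f0 x l) (f0 y l) by rewrite [LHS]ffunE.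
have -> : val ((f (lie x y) : T) l) = X (val l) (val (lie x y)) by exact: f0E.
rewrite [RHS]val_sub_lie !f0E [val (lie x y)]val_sub_lie.
by rewrite [LHS]raddfB /= !XM.
Qed.

End Plesken.

Theorem theorem5p12 (R : realType) (A : algType R[i]) (D : cell_datum A)
    (ssA : semisimple_ring A) :
  [/\ (forall l : cell_poset D, l \in cell_support D ->
         simple_module (cell_module l)),
      (forall l l' : cell_poset D, l \in cell_support D ->
         l' \in cell_support D ->
         module_isomorphic (cell_module l) (cell_module l') -> l = l'),
      (forall V : lmodType A, simple_module V ->
         exists2 l : cell_poset D, l \in cell_support D &
           module_isomorphic V (cell_module l))
    & lie_isomorphic (plesken_lie_algebra (cell_inv D))
        (lie_dsum (fun l : {l : cell_poset D | l \in cell_support D} =>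
           orthogonal_lie R[i]
             (\dim (fullv : {vspace cell_space (val l)}))))].
Proof.
split=> [l _|l l' _ _|V simV|].
- exact: cell_module_simple.
- exact: cell_module_iso_eq.
- by have [l iso] := simple_module_cell D ssA simV; exists l; rewrite ?mem_cell_support.
- exact: plesken_orthogonal_isomorphic.
Qed.
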